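(* Let $n\ge 1$ and let $D[1\ldots n]$ be an array storing a map $f:[n]\to[n]$ as the sequence $f(1),\ldots,f(n)$. If stability is required and it is not allowed to modify the elements of $f$ (the elements stored in $D$ may be moved, but their values may not be changed), then there is an algorithm that rearranges $f$ in-place in (nondecreasing) order of its elements, stably, in $\mathcal{O}(n)$ time using an auxiliary array $E[1\ldots n]$ plus $4\log n$ bits of additional space.
   Context: $[n]=\{1,2,\ldots,n\}$. Computation is on a unit-cost random access machine. ''In-place'' means that at termination the array $D[1\ldots n]$ contains the values $f(1),\ldots,f(n)$ in nondecreasing order. ''Stably'' means that equal elements keep their original relative order: elements are regarded as items with keys $f(i)$, and if $f(i)=f(j)$ with $i<j$, then the item initially at index $i$ precedes the item initially at index $j$ in the final order. $E[1\ldots n]$ is an auxiliary array of $n$ integers. ''Plus $4\log n$ bits'' means that besides $D$ and $E$ the algorithm uses 4 auxiliary variables of $\log n$ bits each (indices or values of magnitude $O(n)$). *)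

(* Defs.v *)
From mathcomp Require Import all_boot all_order all_algebra.

Set Implicit Arguments.
Unset Strict Implicit.
Unset Printing Implicit Defensive.

(** A unit-cost random access machine whose whole read-write memory consists of
    the array D[1..n] of items, the array E[1..n] of integers and four
    registers. Programs do not depend on n.

    An item is named by its initial index, i.e. by an element of 'I_n, so that
    stability can be expressed. A program only ever observes the key of an
    item. Items can be copied from D to a register and from a register to D, so
    the item held while moving the elements of D occupies one of the four
    registers; an integer computed by the program cannot be stored in D. *)

Inductive operand :=
  | Lit of int
  | Len                 (* the array length n *)
  | Reg of 'I_4.

Inductive binop := OpAdd | OpSub | OpMul | OpDiv.

Inductive instr :=
  | Arith  of 'I_4 & binop & operand & operand (* r := x op y *)
  | LoadE  of 'I_4 & operand                   (* r := E[a] *)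
  | StoreE of operand & operand                (* E[a] := x *)
  | LoadD  of 'I_4 & operand                   (* r := D[a] *)
  | StoreD of operand & 'I_4                   (* D[a] := r *)
  | JumpLe of operand & operand & nat.         (* if x <= y then goto l *)

Definition program := seq instr.

Inductive word (n : nat) :=
  | Int of int
  | Item of 'I_n.

Arguments Int {n} z.

Record state (n : nat) := State {
  pc   : nat;
  reg  : 'I_4 -> word n;
  arrE : 'I_n -> int;
  arrD : 'I_n -> 'I_n
}.

(** Array indices and keys seen by programs range over 1..n; the element
    [i : 'I_n] stands for the number i + 1. *)
Definition cell (n : nat) (z : int) : option 'I_n :=
  if z is Posz k.+1 then insub k else None.

Section Semantics.

Variables (n : nat) (f : 'I_n -> 'I_n) (P : program).

Definition word_val (w : word n) : int :=
  match w with
  | Int z => z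
  | Item i => Posz (f i).+1
  end.

Definition operand_val (s : state n) (x : operand) : int :=
  match x with
  | Lit z => z
  | Len => Posz n
  | Reg r => word_val (reg s r)
  end.

Definition binop_val (o : binop) (x y : int) : int :=
  match o with
  | OpAdd => (x + y)%R
  | OpSub => (x - y)%R
  | OpMul => (x * y)%R
  | OpDiv => (x %/ y)%Z
  end.

Definition set_reg (s : state n) (r : 'I_4) (w : word n) : state n :=
  State (pc s).+1 [eta reg s with r |-> w] (arrE s) (arrD s).

Definition set_E (s : state n) (i : 'I_n) (z : int) : state n :=
  State (pc s).+1 (reg s) [eta arrE s with i |-> z] (arrD s).

Definition set_D (s : state n) (p i : 'I_n) : state n :=
  State (pc s).+1 (reg s) (arrE s) [eta arrD s with p |-> i].

Definition goto (s : state n) (l : nat) : state n :=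
  State l (reg s) (arrE s) (arrD s).

(** [None] when there is no instruction to execute, when an index is out of
    bounds, or when a register not holding an item is stored in D. *)
Definition step (s : state n) : option (state n) :=
  match onth P (pc s) with
  | None => None
  | Some (Arith r o x y) =>
      Some (set_reg s r (Int (binop_val o (operand_val s x) (operand_val s y))))
  | Some (LoadE r a) =>
      if cell n (operand_val s a) is Some i
      then Some (set_reg s r (Int (arrE s i))) else None
  | Some (StoreE a x) =>
      if cell n (operand_val s a) is Some i
      then Some (set_E s i (operand_val s x)) else None
  | Some (LoadD r a) =>
      if cell n (operand_val s a) is Some p
      then Some (set_reg s r (Item (arrD s p))) else None
  | Some (StoreD a r) =>
      match cell n (operand_val s a), reg s r with
      | Some p, Item i => Some (set_D s p i)
      | _, _ => None
      end
  | Some (JumpLe x y l) =>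
      Some (goto s (if (operand_val s x <= operand_val s y)%R
                    then l else (pc s).+1))
  end.

Definition run (t : nat) (s : state n) : option (state n) :=
  iter t (obind step) (Some s).

Definition halted (s : state n) : Prop := size P <= pc s.

(** The contents of E and of the registers are not prescribed at the start. *)
Definition initial (s : state n) : Prop :=
  pc s = 0 /\ forall i, arrD s i = i.

Definition fits (m : nat) (s : state n) : Prop :=
  (forall r, absz (word_val (reg s r)) <= m) /\
  (forall i, absz (arrE s i) <= m).

(** [d p] is the item at position p. Injectivity says that every item occurs
    exactly once. *)
Definition stably_sorted (d : 'I_n -> 'I_n) : Prop :=
  [/\ injective d,
      forall p q : 'I_n, p <= q -> f (d p) <= f (d q)
    & forall p q : 'I_n, f (d p) = f (d q) -> d p < d q -> p < q].

End Semantics.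

(** The constant c bounds both the running time and the magnitude of the stored
    integers, at every moment of the computation. *)
Definition stably_sorts_in_linear_time (P : program) (c n : nat)
    (f : 'I_n -> 'I_n) : Prop :=
  forall s0 : state n, initial s0 -> fits f (c * n) s0 ->
  exists (T : nat) (s : state n),
    [/\ T <= c * n,
        run f P T s0 = Some s,
        halted P s,
        stably_sorted f (arrD s)
      & forall (t : nat) (s' : state n), t <= T ->
          run f P t s0 = Some s' -> fits f (c * n) s'].

(* Main.v *)
(** Call an item of D last if no later item has its key. The distinct keys are
    in bijection with the last items, so the cells of E whose numbers are not
    keys are exactly as many as the other items. Move the last item of key v to
    position v, and the other items, in their original order, to the positions
    that are not keys. Then the cell v of E is free to hold the counter of the
    key v, and each other cell of E is free to hold the rank of its item: a
    single array serves for both. After the ranks have been handed out in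
    increasing order, each counter has become the rank of its last item, so E
    contains the stable sorting permutation, which is applied to D cycle by
    cycle. The first move is again a permutation stored in E, computed with two
    bits of extra information per cell. *)

Require Import Defs.
From mathcomp Require Import all_boot all_order all_algebra.
From mathcomp Require Import fingroup perm zify.

Set Implicit Arguments.
Unset Strict Implicit.
Unset Printing Implicit Defensive.

#[local] Arguments cell n z : simpl never.

(** * Structured programs *)

Inductive cmd :=
  | Do of instr
  | Then of cmd & cmd
  | IfLe of operand & operand & cmd & cmd
  | WhileLe of operand & operand & cmd.

Declare Scope cmd_scope.
Delimit Scope cmd_scope with cmd.
Notation "c1 ;; c2" := (Then c1 c2)
  (at level 100, c2 at level 200, right associativity) : cmd_scope.
Bind Scope cmd_scope with cmd.
Coercion Do : instr >-> cmd.

Definition jump (l : nat) : instr := JumpLe (Lit (Posz 0)) (Lit (Posz 0)) l.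

Fixpoint csize (c : cmd) : nat :=
  match c with
  | Do _ => 1
  | Then c1 c2 => csize c1 + csize c2
  | IfLe _ _ c1 c2 => (csize c2 + (csize c1).+1).+1
  | WhileLe _ _ c1 => (csize c1).+3
  end.

(** Jump targets are absolute, hence the load address [b]. The only test jumps when it succeeds, so
    the branch for failure is laid out first, and a loop is left through a second jump. *)
Fixpoint compile (b : nat) (c : cmd) : program :=
  match c with
  | Do i => [:: i]
  | Then c1 c2 => compile b c1 ++ compile (b + csize c1) c2
  | IfLe x y c1 c2 =>
      JumpLe x y (b + (csize c2).+2) :: compile b.+1 c2
        ++ jump (b + csize c) :: compile (b + (csize c2).+2) c1
  | WhileLe x y c1 =>
      [:: JumpLe x y b.+2, jump (b + csize c)
        & rcons (compile b.+2 c1) (jump b)]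
  end.

Lemma size_compile b c : size (compile b c) = csize c.
Proof.
elim: c b => //= [c1 IH1 c2 IH2|x y c1 IH1 c2 IH2|x y c IH] b.
- by rewrite size_cat IH1 IH2.
- by rewrite size_cat /= IH1 IH2.
- by rewrite size_rcons IH.
Qed.

Definition code_at (P : program) (b : nat) (code : program) : Prop :=
  forall j, j < size code -> onth P (b + j) = onth code j.

Lemma code_at_catl P b c1 c2 : code_at P b (c1 ++ c2) -> code_at P b c1.
Proof.
by move=> Pb j lt_j; rewrite Pb ?onth_cat ?lt_j // size_cat ltn_addr.
Qed.

Lemma code_at_catr P b c1 c2 :
  code_at P b (c1 ++ c2) -> code_at P (b + size c1) c2.
Proof.
move=> Pb j lt_j; rewrite -addnA Pb ?size_cat ?ltn_add2l //.
by rewrite onth_cat ltnNge leq_addr /= addKn.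
Qed.

Lemma code_at_cons P b i c :
  code_at P b (i :: c) -> onth P b = Some i /\ code_at P b.+1 c.
Proof.
move=> Pb; split; first by rewrite -[b]addn0 (Pb 0 isT).
by move=> j lt_j; rewrite addSnnS (Pb j.+1 lt_j).
Qed.

(** * Counting below an index *)

Lemma ltnS_neq n (i j : 'I_n) : j <> i -> (j < i.+1) = (j < i).
Proof. by move/eqP; rewrite ltnS ltn_neqAle -val_eqE => ->. Qed.

(** Loop invariants count over the indices already visited: [belowS] is the update at one index,
    [below0] and [belowT] are the two ends of the loop. *)
Definition below n (P : pred 'I_n) (j : nat) : nat :=
  #|[pred c : 'I_n | P c && (c < j)]|.

Lemma below0 n (P : pred 'I_n) : below P 0 = 0.
Proof. by apply: eq_card0 => c; rewrite !inE andbF. Qed.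

Lemma belowS n (P : pred 'I_n) (i : 'I_n) : below P i.+1 = P i + below P i.
Proof.
rewrite /below (cardD1 i) !inE ltnS leqnn andbT; congr (_ + _).
apply: eq_card => c; rewrite !inE; case: eqVneq => [->|/eqP ne_ci] /=.
  by rewrite ltnn andbF.
by rewrite ltnS_neq.
Qed.

Lemma belowT n (P : pred 'I_n) : below P n = #|P|.
Proof. by apply: eq_card => c; rewrite !inE ltn_ord andbT. Qed.

Lemma below_le n (P : pred 'I_n) j : below P j <= n.
Proof. by rewrite -[leqRHS]card_ord max_card. Qed.

Lemma below_mono n (P : pred 'I_n) j j' : j <= j' -> below P j <= below P j'.
Proof.
move=> le_j; apply/subset_leq_card/subsetP=> c; rewrite !inE => /andP[-> lt_c].
exact: leq_trans le_j.
Qed.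

(** * Program logic *)

Notation r0 := (@Ordinal 4 0 isT).
Notation r1 := (@Ordinal 4 1 isT).
Notation r2 := (@Ordinal 4 2 isT).
Notation r3 := (@Ordinal 4 3 isT).

Local Open Scope cmd_scope.

Section Logic.

Variables (n : nat) (f : 'I_n -> 'I_n) (m : nat).

Definition runs (P : program) (t : nat) (s s' : state n) : Prop :=
  run f P t s = Some s' /\
  forall k s'', k <= t -> run f P k s = Some s'' -> fits f m s''.

Lemma run_add P t u s s' :
  run f P t s = Some s' -> run f P (t + u) s = run f P u s'.
Proof. by rewrite /run addnC iterD => ->. Qed.

Lemma runs_trans P t u s s' s'' :
  runs P t s s' -> runs P u s' s'' -> runs P (t + u) s s''.
Proof.
move=> [rt ft] [ru fu]; split=> [|k s3 le_k]; first by rewrite (run_add _ rt).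
have [le_kt|/ltnW le_tk] := leqP k t; first exact: ft.
by rewrite -(subnKC le_tk) (run_add _ rt) => /fu; apply; rewrite leq_subLR.
Qed.

Lemma runs_fits P t s s' : runs P t s s' -> fits f m s'.
Proof. by move=> [rt fs]; apply: fs rt. Qed.

Lemma runs1 P s s' :
  fits f m s -> step f P s = Some s' -> fits f m s' -> runs P 1 s s'.
Proof.
move=> fs st fs'; split=> // k s''.
by case: k => [_ [<-]//|[_|//]]; rewrite /run /= st => -[<-].
Qed.

(** Running [c] from [s] with a budget of [k] steps ends in a state satisfying
    [Q] with the unspent part of the budget. *)
Definition wp (c : cmd) (Q : nat -> state n -> Prop) (k : nat) (s : state n) :=
  forall P b, code_at P b (compile b c) -> fits f m s ->
  exists t k' s',
    [/\ t + k' = k, runs P t (goto s b) (goto s' (b + csize c)) & Q k' s'].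

Lemma wp_step i (Q : nat -> state n -> Prop) k s s' :
    (forall P b, onth P b = Some i ->
       step f P (goto s b) = Some (goto s' b.+1)) ->
    (fits f m s -> fits f m s') ->
  Q k s' -> wp (Do i) Q k.+1 s.
Proof.
move=> st fit Qs P b Pb fs; exists 1, k, s'; split=> //.
apply: runs1 => //; last exact: (fit fs).
by rewrite addn1; apply: st; rewrite -[b]addn0 Pb.
Qed.

Lemma wp_then c1 c2 Q k s : wp c1 (wp c2 Q) k s -> wp (Then c1 c2) Q k s.
Proof.
move=> w P b /= Pb fs.
have [t [k' [s' [<- e1 w2]]]] := w P b (code_at_catl Pb) fs.
have fs' := runs_fits e1.
move/code_at_catr: Pb; rewrite size_compile => Pb2.
have [u [l [s2 [<- e2 Qs]]]] := w2 P _ Pb2 fs'.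
exists (t + u), l, s2; split; rewrite ?addnA //.
exact: runs_trans e1 e2.
Qed.

Lemma wp_mono c (Q Q' : nat -> state n -> Prop) k s :
  (forall k s, Q k s -> Q' k s) -> wp c Q k s -> wp c Q' k s.
Proof.
move=> QQ' w P b Pb fs; have [t [k' [s' [? ? /QQ' ?]]]] := w P b Pb fs.
by exists t, k', s'.
Qed.

Lemma runs_jump P x y l s b :
  onth P b = Some (JumpLe x y l) -> fits f m s ->
  runs P 1 (goto s b)
    (goto s (if (operand_val f s x <= operand_val f s y)%R then l else b.+1)).
Proof. by move=> Pb fs; apply: runs1; rewrite // /step /= Pb. Qed.

(** Success costs one jump. Failure costs two, the test and the jump over [c1]; hence the extra step
    left to [c1]. *)
Lemma wp_if x y c1 c2 Q k s :
    (if (operand_val f s x <= operand_val f s y)%R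
     then wp c1 Q k.+1 s else wp c2 Q k s) ->
  wp (IfLe x y c1 c2) Q k.+2 s.
Proof.
move=> w P b Pb fs.
have [/runs_jump/(_ fs) e1 {}Pb] := code_at_cons Pb.
have Pb2 := code_at_catl Pb.
have := code_at_catr Pb; rewrite size_compile => /code_at_cons[Pj].
rewrite addSn -addnS -addnS => Pb1.
case: ifP w e1 => _ w e1.
- have [t [k' [s' [kE e2 Qs]]]] := w P _ Pb1 fs.
  exists t.+1, k', s'; split=> //; first by rewrite addSn kE.
  have := runs_trans e1 e2; rewrite add1n.
  by congr (runs P _ _ (goto _ _)); rewrite /=; lia.
- have [t [k' [s' [<- e2 Qs]]]] := w P _ Pb2 fs.
  exists t.+2, k', s'; split=> //.
  have := runs_trans (runs_trans e1 e2) (runs_jump Pj (runs_fits e2)).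
  by rewrite /= addn1 add1n.
Qed.

(** Every iteration spends at least two steps, so the budget decreases; the
    potential that pays for the loop is a lower bound on it in [I]. *)
Lemma wp_while x y c (I : nat -> state n -> Prop) Q k s :
    (forall k s, I k s ->
       if (operand_val f s x <= operand_val f s y)%R
       then exists2 k', k = k'.+2 & wp c I k' s
       else exists2 k', k = k'.+2 & Q k' s) ->
  I k s -> wp (WhileLe x y c) Q k s.
Proof.
move=> IQ Is P b Pb fs.
have [k0] := ubnP k; elim: k0 => // k0 IH in k s Is fs *; rewrite ltnS => le_k.
have [/runs_jump/(_ fs) + /code_at_cons[/runs_jump Pj1]] := code_at_cons Pb.
rewrite -cats1 => + Pb2; have Pc := code_at_catl Pb2.
have := code_at_catr Pb2; rewrite size_compile => /code_at_cons[/runs_jump Pj2 _].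
have:= IQ _ _ Is; case: ifP => _ [k' kE w] e1.
- have [t [k1 [s1 [k1E e2 I1]]]] := w P _ Pc fs.
  have fs1 := runs_fits e2.
  have [|u [k2 [s2 [k2E e3 Qs]]]] := IH _ _ I1 fs1; first by lia.
  exists (1 + t + 1 + u), k2, s2; split=> //; first by lia.
  exact: runs_trans (runs_trans (runs_trans e1 e2) (Pj2 _ fs1)) e3.
- exists 2, k', s; split=> //; apply: runs_trans e1 _.
  by have := Pj1 _ fs.
Qed.

(** * Rules for single instructions *)

Lemma wp_arith z r o x y (Q : nat -> state n -> Prop) k s :
    binop_val o (operand_val f s x) (operand_val f s y) = z ->
    (fits f m s -> absz z <= m) ->
  Q k (set_reg s r (Int z)) -> wp (Arith r o x y) Q k.+1 s.
Proof.
move=> xy z_le; apply: wp_step => [P b Pb|fs]; first by rewrite /step Pb -xy.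
by split=> [r'|] /=; [case: eqP => _; [apply: z_le|apply: fs.1]|apply: fs.2].
Qed.

Lemma wp_loadE i z r a (Q : nat -> state n -> Prop) k s :
    cell n (operand_val f s a) = Some i -> arrE s i = z ->
  Q k (set_reg s r (Int z)) -> wp (LoadE r a) Q k.+1 s.
Proof.
move=> ai <-; apply: wp_step => [P b Pb|[fr fe]].
  by rewrite /step Pb -/(operand_val f s a) ai.
by split=> //= r'; case: eqP => _; [apply: fe|apply: fr].
Qed.

(** The bound on [z] may assume [fits], which settles it at once for a value copied from a
    register. *)
Lemma wp_storeE i z a x (Q : nat -> state n -> Prop) k s :
    cell n (operand_val f s a) = Some i -> operand_val f s x = z ->
    (fits f m s -> absz z <= m) ->
  Q k (set_E s i z) -> wp (StoreE a x) Q k.+1 s.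
Proof.
move=> ai xz z_le; apply: wp_step => [P b Pb|fs].
  by rewrite /step Pb -/(operand_val f s a) ai -xz.
by split=> [|j] /=; [apply: fs.1|case: eqP => _; [apply: z_le|apply: fs.2]].
Qed.

(** Room for counters, bounded by [3 * n + 1], and for a number up to [2 * n] that gets doubled in a
    parity test. *)
Hypothesis le_4nm : 4 * n <= m.

Let le_nm : n <= m. Proof. by lia. Qed.

Lemma wp_loadD p i r a (Q : nat -> state n -> Prop) k s :
    cell n (operand_val f s a) = Some p -> arrD s p = i ->
  Q k (set_reg s r (Item i)) -> wp (LoadD r a) Q k.+1 s.
Proof.
move=> ap <-; apply: wp_step => [P b Pb|[fr fe]].
  by rewrite /step Pb -/(operand_val f s a) ap.
by split=> //= r'; case: eqP => //= _; apply: leq_trans le_nm.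
Qed.

Lemma wp_storeD p i a r (Q : nat -> state n -> Prop) k s :
    cell n (operand_val f s a) = Some p -> reg s r = Item i ->
  Q k (set_D s p i) -> wp (StoreD a r) Q k.+1 s.
Proof.
move=> ap ri; apply: wp_step => // P b Pb.
by rewrite /step Pb -/(operand_val f s a) ap /= ri.
Qed.

(** * Hoare triples with a time bound, and counting loops *)

Hypothesis n_gt0 : 0 < n.

Lemma cell_ord (i : 'I_n) : cell n (Posz i.+1) = Some i.
Proof. by rewrite /cell valK. Qed.

(** The arbitrary surplus [k] makes the bounds add up under sequencing; [C] is only an upper bound,
    so branches of unequal cost can share it. *)
Definition hoare (A : state n -> Prop) (c : cmd) (C : nat) (B : state n -> Prop) :=
  forall k s, A s -> wp c (fun k' s' => k <= k' /\ B s') (C + k) s.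

Lemma hoare_then A B D c1 c2 C1 C2 :
  hoare A c1 C1 B -> hoare B c2 C2 D -> hoare A (Then c1 c2) (C1 + C2) D.
Proof.
move=> h1 h2 k s As; apply: wp_then; rewrite -addnA.
apply: wp_mono (h1 _ _ As) => k1 s1 [le_k Bs].
have := h2 (k1 - C2) _ Bs; rewrite subnKC; last by lia.
by apply: wp_mono => k2 s2 [? ?]; split=> //; lia.
Qed.

Lemma hoare_impl A A' B B' c C :
    (forall s, A s -> A' s) -> (forall s, B' s -> B s) ->
  hoare A' c C B' -> hoare A c C B.
Proof.
move=> AA' BB' h k s /AA' A's; apply: wp_mono (h k s A's) => k' s' [? ?].
by split=> //; apply: BB'.
Qed.

Definition for_up (c : cmd) : cmd :=
  (Arith r0 OpAdd (Lit 1) (Lit 0);;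
   WhileLe (Reg r0) Len (c;; Arith r0 OpAdd (Reg r0) (Lit 1))).

Definition for_down (c : cmd) : cmd :=
  (Arith r0 OpAdd Len (Lit 0);;
   WhileLe (Lit 1) (Reg r0) (c;; Arith r0 OpSub (Reg r0) (Lit 1))).

Section For.

Variables (I : nat -> state n -> Prop) (c : cmd) (C : nat).
Hypothesis I_r0 : forall i s w, I i s -> I i (set_reg s r0 w).

(** An iteration pays for the body, the increment and two jumps; the last 3 steps are the
    initialization and the exit. The invariant must ignore [r0], which the loop itself changes. *)
Lemma hoare_for_up :
    (forall i : 'I_n, hoare (fun s => reg s r0 = Int (Posz i.+1) /\ I i s) c C
                            (fun s => reg s r0 = Int (Posz i.+1) /\ I i.+1 s)) ->
  hoare (I 0) (for_up c) (n * (C + 3) + 3) (I n).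
Proof.
move=> body k s Is; apply: wp_then; rewrite addn3 !addSn.
apply: wp_arith; [by []|by move=> /=; lia|].
pose J k' s := exists2 j, j <= n &
  [/\ reg s r0 = Int (Posz j.+1), I j s & (n - j) * (C + 3) + 2 + k <= k'].
apply: (@wp_while _ _ _ J); last first.
  by exists 0; rewrite // subn0; split=> //; [exact: I_r0|lia].
move=> {s Is} k' s [j le_jn [s_r0 Is le_k]]; rewrite /= s_r0 /=.
case: ifP => lt_jn; last first.
  exists k'.-2; first by lia.
  have -> : n = j by lia.
  by split=> //; lia.
have {}lt_jn : j < n by lia.
exists k'.-2; first by lia.
apply: wp_then.
have := body (Ordinal lt_jn) (k'.-2 - C) s (conj s_r0 Is).
(* The share of one iteration is split off the potential explicitly, because the product is
   nonlinear for [lia]. *)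
have e : (n - j) * (C + 3) = (n - j.+1) * (C + 3) + C + 3.
  by rewrite -(subnSK lt_jn) mulSn; lia.
rewrite {}e in le_k.
rewrite subnKC; last by move: (_ * _) le_k => q; lia.
apply: wp_mono => k1 s1 [le_k1 [s1_r0 Is1]].
case: k1 => [|k1] in le_k1 *; first by move: (_ * _) le_k => q; lia.
apply: wp_arith; [by rewrite /= s1_r0|by move=> /=; lia|].
exists j.+1 => //; split; [|exact: I_r0|lia].
by rewrite /=; congr Int; lia.
Qed.

Lemma hoare_for_down :
    (forall i : 'I_n, hoare (fun s => reg s r0 = Int (Posz i.+1) /\ I i.+1 s) c C
                            (fun s => reg s r0 = Int (Posz i.+1) /\ I i s)) ->
  hoare (I n) (for_down c) (n * (C + 3) + 3) (I 0).
Proof.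
move=> body k s Is; apply: wp_then; rewrite addn3 !addSn.
apply: wp_arith; [by []|by move=> /=; lia|].
pose J k' s := exists2 j, j <= n &
  [/\ reg s r0 = Int (Posz j), I j s & j * (C + 3) + 2 + k <= k'].
apply: (@wp_while _ _ _ J); last first.
  by exists n => //; split; [rewrite /=; congr Int; lia|exact: I_r0|lia].
move=> {s Is} k' s [j le_jn [s_r0 Is le_k]]; rewrite /= s_r0 /=.
case: j => [|j] in le_jn s_r0 Is le_k *; rewrite /=.
  by exists k'.-2; [|split=> //]; lia.
exists k'.-2; first by lia.
apply: wp_then.
have := body (Ordinal le_jn) (k'.-2 - C) s (conj s_r0 Is).
rewrite mulSn in le_k.
rewrite subnKC; last by move: (_ * _) le_k => q; lia.
apply: wp_mono => k1 s1 [le_k1 [s1_r0 Is1]].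
case: k1 => [|k1] in le_k1 *; first by move: (_ * _) le_k => q; lia.
apply: wp_arith; [by rewrite /= s1_r0|by move=> /=; lia|].
exists j; first exact: ltnW.
split; [|exact: I_r0|lia].
by rewrite /=; congr Int; lia.
Qed.

End For.

(** * Clearing, halving and permuting *)

Definition clear_E : cmd := for_up (StoreE (Reg r0) (Lit 0)).

Lemma hoare_clear_E (d : 'I_n -> 'I_n) :
  hoare (fun s => arrD s =1 d) clear_E (n * 4 + 3)
        (fun s => arrD s =1 d /\ forall i, arrE s i = 0%R).
Proof.
pose I j s := arrD s =1 d /\ forall i : 'I_n, i < j -> arrE s i = 0%R.
apply: (@hoare_impl _ (I 0) _ (I n)) => [s ds|s [ds Es]|].
- by split.
- by split=> // i; apply: Es.
apply: (@hoare_for_up I _ 1) => // i k s [s_r0 [ds Es]].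
apply: (@wp_storeE i 0%R); rewrite /= ?s_r0 ?cell_ord //.
do 3?split=> //.
by move=> j /=; case: eqP => // ne_ji; rewrite ltnS_neq //; apply: Es.
Qed.

Definition halve_E : cmd :=
  for_up (LoadE r1 (Reg r0);; Arith r1 OpDiv (Reg r1) (Lit 2);;
          StoreE (Reg r0) (Reg r1)).

(** Dropping the parity bit leaves the bare cell numbers that [permute] expects. *)
Lemma hoare_halve_E (d : 'I_n -> 'I_n) (b : 'I_n -> bool) (t : 'I_n -> nat) :
  hoare (fun s => arrD s =1 d /\ forall i, arrE s i = Posz (b i + (t i).*2))
    halve_E (n * 6 + 3)
    (fun s => arrD s =1 d /\ forall i, arrE s i = Posz (t i)).
Proof.
pose I j s := arrD s =1 d /\ forall i : 'I_n,
  arrE s i = Posz (if i < j then t i else b i + (t i).*2).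
apply: (@hoare_impl _ (I 0) _ (I n)) => [s ds|s [ds Es]|].
- by split; case: ds.
- by split=> // i; rewrite Es ltn_ord.
apply: (@hoare_for_up I _ 3) => // i k s [s_r0 [ds Es]].
apply: wp_then; apply: (@wp_loadE i (Posz (b i + (t i).*2)));
  rewrite /= ?s_r0 ?cell_ord ?Es ?ltnn //.
apply: wp_then.
apply: (wp_arith (z := Posz (t i))) => /=.
- by rewrite divz_nat divn2 half_bit_double.
- move=> [] /(_ r1) /=; lia.
apply: (@wp_storeE i (t i)); rewrite /= ?s_r0 ?cell_ord //.
  by move=> [] /(_ r1).
do 3?split=> //; move=> j /=; rewrite Es.
case: eqP => [->|ne_ji]; last by rewrite ltnS_neq.
by rewrite ltnS leqnn.
Qed.

(** Swapping the cells [a] and [E a] puts the item of [a] in its final place and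
    the number of moved points decreases. *)
Definition permute : cmd :=
  Arith r0 OpAdd (Lit 1) (Lit 0);;
  WhileLe (Reg r0) Len
    (LoadE r1 (Reg r0);;
     IfLe (Reg r1) (Reg r0)
       (Arith r0 OpAdd (Reg r0) (Lit 1))
       (LoadD r2 (Reg r0);; LoadD r3 (Reg r1);;
        StoreD (Reg r1) r2;; StoreD (Reg r0) r3;;
        LoadE r2 (Reg r1);; StoreE (Reg r1) (Reg r1);;
        StoreE (Reg r0) (Reg r2))).

(** The point [sigma a] was moved, by injectivity, and becomes fixed; every point moved afterwards
    was moved before. *)
Lemma card_moved_tperm (a : 'I_n) (sigma : {perm 'I_n}) : sigma a != a ->
  #|[pred p | (tperm a (sigma a) * sigma)%g p != p]| < #|[pred p | sigma p != p]|.
Proof.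
move=> ne; apply: proper_card; apply/properP; split.
  apply/subsetP=> p; rewrite !inE permM.
  case: tpermP => [->|->|//]; first by rewrite ne.
  by rewrite (inj_eq perm_inj) ne.
exists (sigma a); rewrite !inE ?permM ?tpermR ?eqxx //.
by rewrite (inj_eq perm_inj).
Qed.

(** Each iteration advances the cursor or lowers the number of moved points, so [2 * n] iterations
    suffice. The longest one, a swap, takes 12 steps including the loop jumps. *)
Lemma hoare_permute (d : 'I_n -> 'I_n) :
  hoare (fun s => exists sigma : {perm 'I_n},
           (forall p, arrE s p = Posz (sigma p).+1) /\
           (forall p, d (sigma p) = arrD s p))
    permute (2 * n * 12 + 3) (fun s => arrD s =1 d).
Proof.
move=> k s [sigma [Es Ds]]; apply: wp_then; rewrite addn3 !addSn.
apply: wp_arith; [by []|by move=> /=; lia|].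
pose J k' s := exists (i : nat) (sigma : {perm 'I_n}),
  [/\ [/\ i <= n, reg s r0 = Int (Posz i.+1) & forall p : 'I_n, p < i -> sigma p = p],
      forall p, arrE s p = Posz (sigma p).+1,
      forall p, d (sigma p) = arrD s p &
      (n - i + #|[pred p | sigma p != p]|) * 12 + 2 + k <= k'].
apply: (@wp_while _ _ _ J); last first.
  exists 0, sigma; split=> //; rewrite subn0.
  have : #|[pred p | sigma p != p]| <= n by rewrite -[leqRHS]card_ord max_card.
  lia.
move=> {s sigma Es Ds} k' s [i [sigma [[le_in s_r0 fix_i] Es Ds le_k]]].
rewrite /= s_r0 /=; case: ifP => lt_in; last first.
  exists k'.-2; first by lia.
  split; first by lia.
  by move=> p; rewrite -Ds fix_i // (leq_trans (ltn_ord p)) //; lia.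
exists k'.-2; first by lia.
have {}lt_in : i < n by lia.
have [a iE] : exists a : 'I_n, i = a by exists (Ordinal lt_in).
rewrite {i}iE in le_in s_r0 fix_i le_k lt_in *.
have [k2 k'E] : exists k2, k' = 12 + k2 by exists (k' - 12); lia.
rewrite {k'}k'E in le_k *.
apply: wp_then; apply: (@wp_loadE a (Posz (sigma a).+1));
  rewrite /= ?s_r0 ?cell_ord //.
apply: wp_if; rewrite /= s_r0 /=; case: ifP => [le_b|lt_b].
  (* All cells below the cursor are fixed, so by injectivity none of them can be the target of [a];
     this is why testing [<=] detects a fixed point. *)
  have fix_a : sigma a = a.
    have: sigma a <= a by lia.
    by rewrite leq_eqVlt => /orP[/eqP/val_inj//|/fix_i/perm_inj].
  apply: (@wp_arith (Posz a.+2)); [by rewrite /= s_r0 /=; lia|by move=> _ /=; lia|].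
  exists a.+1, sigma; split; [split=> //|exact: Es|exact: Ds|].
    move=> p; rewrite ltnS leq_eqVlt => /orP[/eqP pa|/fix_i//].
    by have -> : p = a by apply: val_inj.
  by rewrite -(subnSK lt_in) in le_k; lia.
have lt_a : a < sigma a by lia.
have ne_a : sigma a != a by rewrite -val_eqE gtn_eqF.
set b := sigma a in lt_b lt_a ne_a *.
apply: wp_then; apply: (@wp_loadD a (arrD s a)); rewrite /= ?s_r0 ?cell_ord //.
apply: wp_then; apply: (@wp_loadD b (arrD s b)); rewrite /= ?cell_ord //.
apply: wp_then; apply: (@wp_storeD b (arrD s a)); rewrite /= ?cell_ord //.
apply: wp_then; apply: (@wp_storeD a (arrD s b)); rewrite /= ?s_r0 ?cell_ord //.
apply: wp_then; apply: (@wp_loadE b (Posz (sigma b).+1)); rewrite /= ?cell_ord //.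
apply: wp_then; apply: (@wp_storeE b (Posz b.+1)); rewrite /= ?cell_ord //.
  by move=> _; have := ltn_ord b; lia.
apply: (@wp_storeE a (Posz (sigma b).+1)); rewrite /= ?s_r0 ?cell_ord //.
  by move=> _; have := ltn_ord (sigma b); lia.
exists a, (tperm a b * sigma)%g; split.
- split=> // p lt_pi; rewrite permM tpermD ?fix_i //.
    by rewrite -val_eqE gtn_eqF.
  by rewrite -val_eqE gtn_eqF // (ltn_trans lt_pi).
- move=> p /=; rewrite permM; case: tpermP => [->|->|/eqP/negPf ne_pa /eqP/negPf ne_pb].
  + by rewrite eqxx.
  + by rewrite (negPf ne_a) eqxx.
  + by rewrite ne_pa ne_pb Es.
- move=> p /=; rewrite permM; case: tpermP => [->|->|/eqP/negPf ne_pa /eqP/negPf ne_pb].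
  + by rewrite eqxx Ds.
  + by rewrite (negPf ne_a) eqxx -/b Ds.
  + by rewrite ne_pa ne_pb Ds.
have := card_moved_tperm ne_a; rewrite -/b.
by move: #|_| #|_| le_k => q q' ? ?; lia.
Qed.

(** * Ranks of the items once laid out *)

Section Ranking.

Variable d : 'I_n -> 'I_n.

Let g p := f (d p).

Definition count_keys : cmd :=
  for_up (LoadD r1 (Reg r0);; LoadE r2 (Reg r1);;
          Arith r2 OpAdd (Reg r2) (Lit 1);; StoreE (Reg r1) (Reg r2)).

Lemma hoare_count_keys :
  hoare (fun s => arrD s =1 d /\ forall i, arrE s i = 0%R)
    count_keys (n * 7 + 3)
    (fun s => arrD s =1 d /\ forall v, arrE s v = Posz #|[pred p | g p == v]|).
Proof.
pose I j s := arrD s =1 d /\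
  forall v, arrE s v = Posz (below [pred p | g p == v] j).
apply: (@hoare_impl _ (I 0) _ (I n)) => [s [Ds Es]|s [Ds Es]|].
- by split=> // v; rewrite Es below0.
- by split=> // v; rewrite Es belowT.
apply: (@hoare_for_up I _ 4) => // i k s [s_r0 [Ds Es]].
apply: wp_then; apply: (@wp_loadD i (d i)); rewrite /= ?s_r0 ?cell_ord ?Ds //.
apply: wp_then; apply: (@wp_loadE (g i) (Posz (below [pred p | g p == g i] i)));
  rewrite /= ?cell_ord ?Es //.
apply: wp_then; apply: (@wp_arith (Posz (below [pred p | g p == g i] i.+1))) => /=.
- by rewrite belowS /= eqxx; lia.
- by have := below_le [pred p | g p == g i] i.+1; lia.
apply: (@wp_storeE (g i) (Posz (below [pred p | g p == g i] i.+1)));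
  rewrite /= ?cell_ord //.
  by move=> [] /(_ r2).
do 3?split=> //; move=> v /=; rewrite Es; case: eqP => [->//|/eqP ne_v].
by rewrite belowS /= eq_sym (negPf ne_v).
Qed.

(** Exclusive prefix sums of the class sizes, started at 1 because cells are numbered from 1. *)
Definition start_ranks : cmd :=
  Arith r1 OpAdd (Lit 1) (Lit 0);;
  for_up (LoadE r2 (Reg r0);; StoreE (Reg r0) (Reg r1);;
          Arith r1 OpAdd (Reg r1) (Reg r2)).

Lemma card_keysS v :
  #|[pred p | g p < v.+1]| = #|[pred p | g p < v]| + #|[pred p | g p == v :> nat]|.
Proof.
rewrite -cardUI -[LHS]addn0; congr (_ + _).
  by apply: eq_card => p; rewrite !inE ltnS leq_eqVlt orbC.
by apply/esym/eq_card0 => p; rewrite !inE; case: ltngtP.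
Qed.

Lemma hoare_start_ranks :
  hoare (fun s => arrD s =1 d /\ forall v, arrE s v = Posz #|[pred p | g p == v]|)
    start_ranks (n * 6 + 4)
    (fun s => arrD s =1 d /\
       forall v : 'I_n, arrE s v = Posz #|[pred p | g p < v]|.+1).
Proof.
have le_n (P : pred 'I_n) : #|P| <= n by rewrite -[leqRHS]card_ord max_card.
pose I j s := [/\ arrD s =1 d, reg s r1 = Int (Posz #|[pred p | g p < j]|.+1) &
  forall v : 'I_n, arrE s v =
    Posz (if v < j then #|[pred p | g p < v]|.+1 else #|[pred p | g p == v]|)].
move=> k s [Ds Es]; apply: wp_then.
rewrite (_ : n * 6 + 4 + k = (n * (3 + 3) + 3 + k).+1); last by lia.
apply: (@wp_arith 1%R) => //=; first by lia.
have {Ds Es} : I 0 (set_reg s r1 (Int 1)).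
  by split=> //=; congr (Int (Posz _.+1)); apply/esym/eq_card0 => p; rewrite !inE.
move: (set_reg _ _ _) => {}s; move: k s.
apply: (@hoare_impl _ (I 0) _ (I n)) => [//|s [Ds _ Es]|].
  by split=> // v; rewrite Es ltn_ord.
apply: (@hoare_for_up I _ 3) => [j s w []|i k s [s_r0 [Ds s_r1 Es]]] //.
apply: wp_then; apply: (@wp_loadE i (Posz #|[pred p | g p == i]|));
  rewrite /= ?s_r0 ?cell_ord ?Es ?ltnn //.
apply: wp_then; apply: (@wp_storeE i (Posz #|[pred p | g p < i]|.+1));
  rewrite /= ?s_r0 ?s_r1 ?cell_ord //.
  by move=> [] /(_ r1); rewrite /= s_r1.
apply: (@wp_arith (Posz #|[pred p | g p < i.+1]|.+1)) => /=.
- by rewrite s_r1 /= card_keysS; congr Posz; rewrite addSn.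
- by move=> _; have := le_n [pred p | g p < i.+1]; move: #|_| => q; lia.
split=> //; split=> //; split=> // v /=; rewrite Es.
case: eqP => [->|ne_vi]; last by rewrite ltnS_neq.
by rewrite ltnS leqnn.
Qed.

(** The order of the two stores matters: when [r0] and [r1] address the same cell, the second undoes
    the increment, so a last item does not advance its own counter. *)
Definition set_ranks : cmd :=
  for_up (LoadD r1 (Reg r0);; LoadE r2 (Reg r1);;
          Arith r3 OpAdd (Reg r2) (Lit 1);;
          StoreE (Reg r1) (Reg r3);; StoreE (Reg r0) (Reg r2)).

(** A cell holding its own key acts as the counter of its class, and what it
    contains at the end is the rank of the last item of the class. *)
Lemma hoare_set_ranks :
    (forall p, g (g p) = g p) ->
  hoare (fun s => arrD s =1 d /\
           forall v : 'I_n, arrE s v = Posz #|[pred p | g p < v]|.+1)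
    set_ranks (n * 8 + 3)
    (fun s => arrD s =1 d /\ forall c : 'I_n, arrE s c =
       Posz (#|[pred p | g p < g c]| +
             below [pred p | (g p == g c) && (p != g p)]
                   (if g c == c then n else c)).+1).
Proof.
move=> gg.
pose cnt (v : 'I_n) j :=
  (#|[pred p | g p < v]| + below [pred p | (g p == v) && (p != g p)] j).+1.
pose I j s := [/\ arrD s =1 d, forall c, g c = c -> arrE s c = Posz (cnt c j) &
  forall c : 'I_n, g c <> c -> c < j -> arrE s c = Posz (cnt (g c) c)].
have le_n (P : pred 'I_n) : #|P| <= n by rewrite -[leqRHS]card_ord max_card.
have cnt_le v j : cnt v j <= 3 * n.
  have := below_le [pred p | (g p == v) && (p != g p)] j.
  have := le_n [pred p | g p < v]; rewrite /cnt; move: #|_| => q; lia.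
apply: (@hoare_impl _ (I 0) _ (I n)) => [s [Ds Es]|s [Ds Es Es']|].
- by split=> // c _; rewrite Es /cnt below0 addn0.
- split=> // c; case: eqP => [gc|ne_gc]; last exact: Es'.
  by rewrite Es // /cnt gc.
apply: (@hoare_for_up I _ 5) => [j s w []|i k s [s_r0 [Ds Es Es']]] //.
apply: wp_then; apply: (@wp_loadD i (d i)); rewrite /= ?s_r0 ?cell_ord ?Ds //.
apply: wp_then; apply: (@wp_loadE (g i) (Posz (cnt (g i) i)));
  rewrite /= ?cell_ord ?Es ?gg //.
apply: wp_then; apply: (@wp_arith (Posz (cnt (g i) i).+1)) => /=.
- by lia.
- by move=> _; have := cnt_le (g i) i; lia.
apply: wp_then; apply: (@wp_storeE (g i) (Posz (cnt (g i) i).+1));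
  rewrite /= ?cell_ord //.
  by move=> [] /(_ r3).
apply: (@wp_storeE i (Posz (cnt (g i) i)));
  rewrite /= ?s_r0 ?cell_ord //.
  by move=> [] /(_ r2).
split=> //; split=> //; split=> // c /=.
- case: eqP => [-> gi|ne_ci gc].
    by rewrite gi /cnt belowS /= gi !eqxx.
  case: eqP => [c_gi|/eqP ne_cgi].
    by rewrite c_gi /cnt belowS /= eqxx -c_gi eq_sym (introF eqP ne_ci) /= addnS.
  by rewrite Es // /cnt belowS /= [g i == c]eq_sym (negPf ne_cgi).
(* A rank already written is never overwritten by a counter, since a counter cell [g i] satisfies
   [g (g i) = g i]. *)
- move=> ne_gc; case: eqP => [->//|ne_ci].
  case: eqP => [c_gi|_]; first by case: ne_gc; rewrite c_gi gg.
  by rewrite ltnS_neq //; apply: Es'.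
Qed.

End Ranking.

(** * The layout of the items *)

Definition is_key (v : 'I_n) : bool := [exists j, f j == v].

Definition last_occ (i : 'I_n) : bool := [forall j, (f j == f i) ==> (j <= i)].

(** The parity of [E v] tells whether [v] has been met as a key, and half of
    [E c] is the number of the target cell of the item [c], or 0
    while it is not known. *)
Definition mark : cmd :=
  for_down
    (LoadD r1 (Reg r0);; LoadE r2 (Reg r1);;
     Arith r3 OpDiv (Reg r2) (Lit 2);; Arith r3 OpAdd (Reg r3) (Reg r3);;
     IfLe (Reg r2) (Reg r3)
       (Arith r2 OpAdd (Reg r2) (Lit 1);; StoreE (Reg r1) (Reg r2);;
        LoadE r2 (Reg r0);; Arith r1 OpAdd (Reg r1) (Reg r1);;
        Arith r2 OpAdd (Reg r2) (Reg r1);; StoreE (Reg r0) (Reg r2))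
       (Arith r1 OpAdd (Lit 0) (Lit 0))).

(** The scan runs downwards, so the first item met with a given key is the last of its class. As
    [r3] is twice the half of [r2], the test holds exactly when [r2] is even; the other branch
    stands for an empty command. *)
Lemma hoare_mark :
  hoare (fun s => arrD s =1 id /\ forall i, arrE s i = 0%R)
    mark (n * 15 + 3)
    (fun s => arrD s =1 id /\ forall c, arrE s c =
       Posz (is_key c + (if last_occ c then (f c).+1 else 0).*2)).
Proof.
pose seen j (v : 'I_n) := [exists i : 'I_n, (j <= i) && (f i == v)].
pose late j (c : 'I_n) := if (j <= c) && last_occ c then (f c).+1 else 0.
pose I j s := arrD s =1 id /\
  forall c : 'I_n, arrE s c = Posz (seen j c + (late j c).*2).
have late_le j c : late j c <= n by rewrite /late; case: ifP => // _; apply: ltn_ord.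
apply: (@hoare_impl _ (I n) _ (I 0)) => [s [Ds Es]|s [Ds Es]|].
- split=> // c; rewrite Es /late leqNgt ltn_ord /=.
  suff -> : seen n c = false by [].
  by apply/negbTE/existsPn=> i; rewrite leqNgt ltn_ord.
- by split=> // c; rewrite Es.
apply: (@hoare_for_down I _ 12) => // i k s [s_r0 [Ds Es]].
have seenS (c : 'I_n) : seen i c = (f i == c) || seen i.+1 c.
  apply/existsP/orP => [[j /andP[le_ij /eqP fj]]|[/eqP fi|/existsP[j /andP[lt_ij fj]]]].
  - move: le_ij; rewrite leq_eqVlt => /orP[/eqP/val_inj ij|lt_ij].
      by left; rewrite ij fj.
    by right; apply/existsP; exists j; rewrite lt_ij fj eqxx.
  - by exists i; rewrite leqnn fi eqxx.
  - by exists j; rewrite fj ltnW.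
have seen_last : last_occ i = ~~ seen i.+1 (f i).
  apply/forallP/existsPn => [last_i j|nseen j].
    by have := last_i j; case: eqP; rewrite ?andbF //= andbT -leqNgt.
  by have := nseen j; case: eqP; rewrite ?andbF //= andbT -leqNgt.
have lateS c : c <> i -> late i c = late i.+1 c.
  by rewrite /late => ne_ci; rewrite leq_eqVlt eq_sym val_eqE (introF eqP ne_ci).
have late_i : late i.+1 i = 0 by rewrite /late ltnn.
apply: wp_then; apply: (@wp_loadD i i); rewrite /= ?s_r0 ?cell_ord ?Ds //.
set b := seen i.+1 (f i) in seen_last; set t := late i.+1 (f i).
apply: wp_then; apply: (@wp_loadE (f i) (Posz (b + t.*2)));
  rewrite /= ?cell_ord ?Es //.
apply: wp_then; apply: (@wp_arith (Posz t)) => /=.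
- by rewrite divz_nat divn2 half_bit_double.
- by have := late_le i.+1 (f i); rewrite -/t; lia.
apply: wp_then; apply: (@wp_arith (Posz t.*2)) => /=.
- by lia.
- by have := late_le i.+1 (f i); rewrite -/t; lia.
apply: wp_if; rewrite /=; case: ifP => cond; last first.
  have bT : b by move: cond; case: (b) => //; lia.
  apply: (@wp_arith 0%R) => //=; split; first by lia.
  split=> //; split=> // c /=; rewrite Es seenS.
  case: (eqVneq c i) => [->|/eqP/lateS->].
    rewrite late_i /late leqnn seen_last bT /=; congr (Posz (nat_of_bool _ + _)).
    by case: eqP => //= fi; move: bT; rewrite /b fi => ->.
  by case: eqP => //= <-; rewrite -/b bT.
have bF : b = false by move: cond; case: (b) => //; lia.
apply: wp_then; apply: (@wp_arith (Posz t.*2.+1)) => /=.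
- by rewrite bF; lia.
- by have := late_le i.+1 (f i); rewrite -/t; lia.
apply: wp_then; apply: (@wp_storeE (f i) (Posz t.*2.+1));
  rewrite /= ?cell_ord //.
  by move=> [] /(_ r2).
(* Cell [i] is read after its key has been marked, because [f i] may be [i]. Its half is still 0, so
   only the parity bit is found. *)
apply: wp_then; apply: (@wp_loadE i (Posz (seen i i))); rewrite /= ?s_r0 ?cell_ord //.
  rewrite seenS Es late_i eq_sym; case: eqP => [fi|_]; last by rewrite addn0.
  by rewrite /t fi late_i.
apply: wp_then; apply: (@wp_arith (Posz (f i).+1.*2)) => /=.
- by lia.
- by have := ltn_ord (f i); lia.
apply: wp_then; apply: (@wp_arith (Posz (seen i i + (f i).+1.*2))) => /=.
- by lia.
- by have := ltn_ord (f i); case: (seen i i); lia.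
apply: (@wp_storeE i (Posz (seen i i + (f i).+1.*2))); rewrite /= ?s_r0 ?cell_ord //.
  by move=> [] /(_ r2).
split=> //; split=> //; split=> // c /=.
case: eqP => [->|ne_ci]; first by rewrite /late leqnn seen_last bF.
rewrite lateS // seenS eq_sym; case: eqP => [fc|_]; last exact: Es.
by rewrite -fc -/t.
Qed.

(** * Last items and keys are equinumerous *)

Lemma last_occ_inj : {in last_occ &, injective f}.
Proof.
move=> i j /forallP/(_ j) + /forallP/(_ i) + fij.
by rewrite fij eqxx /= => le_ij le_ji; apply/val_inj/anti_leq/andP.
Qed.

Lemma ex_last_occ v : is_key v -> exists2 i, last_occ i & f i = v.
Proof.
case/existsP=> j fj.
case: (@arg_maxnP _ j (fun i => f i == v) val fj) => i /eqP fi max_i.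
by exists i => //; apply/forallP=> j'; apply/implyP; rewrite fi; apply: max_i.
Qed.

Lemma card_last_occ : #|last_occ| = #|is_key|.
Proof.
rewrite -(card_in_imset last_occ_inj); apply: eq_card => v.
apply/imsetP/idP => [[i _ ->]|/ex_last_occ[i li <-]]; last by exists i.
by apply/existsP; exists i.
Qed.

(** This keeps the cell cursor of [place] inside the array as long as an item remains to be
    placed. *)
Lemma card_not_last_occ : #|[pred c | ~~ last_occ c]| = #|[pred c | ~~ is_key c]|.
Proof. by apply: (@addnI #|last_occ|); rewrite {2}card_last_occ !cardC. Qed.

(** The last item of each class goes to the cell numbered by its key, and the
    other items go, in order, to the cells numbered by non-keys. *)
Definition layout (tau : 'I_n -> 'I_n) : Prop :=
  [/\ forall c, last_occ c -> tau c = f c,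
      forall c, ~~ last_occ c -> ~~ is_key (tau c)
    & forall c c' : 'I_n, ~~ last_occ c -> ~~ last_occ c' -> c < c' -> tau c < tau c'].

(** [r0] runs through the items and [r1] through the cells that are not keys, so
    the amortized cost is bounded by [2 * n - (i + x)]. *)
Definition place : cmd :=
  Arith r0 OpAdd (Lit 1) (Lit 0);; Arith r1 OpAdd (Lit 1) (Lit 0);;
  WhileLe (Reg r0) Len
    (LoadE r2 (Reg r0);;
     IfLe (Lit 2) (Reg r2)
       (Arith r0 OpAdd (Reg r0) (Lit 1))
       (LoadE r2 (Reg r1);;
        Arith r3 OpDiv (Reg r2) (Lit 2);; Arith r3 OpAdd (Reg r3) (Reg r3);;
        IfLe (Reg r2) (Reg r3)
          (LoadE r2 (Reg r0);; Arith r3 OpAdd (Reg r1) (Reg r1);;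
           Arith r2 OpAdd (Reg r2) (Reg r3);; StoreE (Reg r0) (Reg r2);;
           Arith r0 OpAdd (Reg r0) (Lit 1);; Arith r1 OpAdd (Reg r1) (Lit 1))
          (Arith r1 OpAdd (Reg r1) (Lit 1)))).

(** A content of at least 2 means that the target is known. Otherwise the half is 0, and the new
    target is added without disturbing the parity bit. The factor 16 pays for the longest
    iteration. *)
Lemma hoare_place :
  hoare (fun s => arrD s =1 id /\ forall c, arrE s c =
           Posz (is_key c + (if last_occ c then (f c).+1 else 0).*2))
    place (2 * n * 16 + 4)
    (fun s => exists2 tau, layout tau & arrD s =1 id /\
       forall c, arrE s c = Posz (is_key c + (tau c).+1.*2)).
Proof.
pose partial i x (tau : 'I_n -> 'I_n) :=
  [/\ forall c, last_occ c -> tau c = f c,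
      forall c : 'I_n, c < i -> ~~ last_occ c -> ~~ is_key (tau c) /\ tau c < x
    & forall c c' : 'I_n, ~~ last_occ c -> ~~ last_occ c' -> c < c' -> c' < i ->
        tau c < tau c'].
pose code i (tau : 'I_n -> 'I_n) (c : 'I_n) :=
  is_key c + (if last_occ c || (c < i) then (tau c).+1 else 0).*2.
have code_le i tau c : code i tau c <= 3 * n.
  rewrite /code; have := ltn_ord (tau c).
  by case: (is_key c); case: ifP; lia.
pose J k k' s := exists i x tau,
  [/\ [/\ i <= n, x <= n, reg s r0 = Int (Posz i.+1), reg s r1 = Int (Posz x.+1)
        & arrD s =1 id],
      forall c, arrE s c = Posz (code i tau c), partial i x tau,
      below [pred c | ~~ last_occ c] i = below [pred c | ~~ is_key c] x
    & (2 * n - (i + x)) * 16 + 2 + k <= k'].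
move=> k s [Ds Es].
rewrite (_ : 2 * n * 16 + 4 + k = (2 * n * 16 + 2 + k).+2); last by lia.
apply: wp_then; apply: (@wp_arith 1%R) => //=; first by lia.
apply: wp_then; apply: (@wp_arith 1%R) => //=; first by lia.
apply: (@wp_while _ _ _ (J k)); last first.
  (* At the start [f] serves as [tau]: it is right on last items, and the other items are not
     constrained yet. *)
  exists 0, 0, f; split=> [//|c|//||]; rewrite ?below0 //; last by lia.
  by rewrite /= Es /code orbF.
move=> {s Ds Es} k' s [i [x [tau [[le_in le_xn s_r0 s_r1 Ds] Es]]]].
move=> [tau_last tau_key tau_mono] cnt le_k.
rewrite /= s_r0 /=; case: ifP => lt_in; last first.
  exists k'.-2; first by lia.
  split; first by lia.
  have iE : i = n by lia.
  rewrite {}iE in Es tau_key tau_mono; exists tau.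
    split=> // [c nlc|c c' nlc nlc' lt_cc']; last exact: tau_mono.
    by have [] := tau_key c (ltn_ord c) nlc.
  by split=> // c; rewrite Es /code ltn_ord orbT.
exists k'.-2; first by lia.
have {}lt_in : i < n by lia.
have [a iE] : exists a : 'I_n, i = a by exists (Ordinal lt_in).
rewrite {i}iE in le_in s_r0 Es tau_key tau_mono cnt le_k lt_in *.
have [k2 k'E] : exists k2, k' = 16 + k2 by exists (k' - 16); lia.
rewrite {k'}k'E in le_k *.
apply: wp_then; apply: (@wp_loadE a (Posz (code a tau a)));
  rewrite /= ?s_r0 ?cell_ord //.
have code_a : code a tau a = is_key a + (if last_occ a then (tau a).+1 else 0).*2.
  by rewrite /code ltnn orbF.
apply: wp_if; rewrite /= code_a; case: ifP => [le_2|lt_2].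
  have last_a : last_occ a by move: le_2; case: (is_key a); case: last_occ.
  apply: (@wp_arith (Posz a.+2)); [by rewrite /= s_r0 /=; lia|by move=> _ /=; lia|].
  exists a.+1, x, tau; split=> //.
  - move=> c; rewrite /= Es /code; case: (eqVneq c a) => [->|/eqP ne_ca].
      by rewrite last_a.
    by rewrite ltnS_neq.
  - split=> //.
      move=> c lt_c nlc; apply: tau_key => //.
      by rewrite -(@ltnS_neq _ a) // => ca; move: nlc; rewrite ca last_a.
    move=> c c' nlc nlc' lt_cc' lt_c'; apply: tau_mono => //.
    by rewrite -(@ltnS_neq _ a) // => ca; move: nlc'; rewrite ca last_a.
  - by rewrite belowS /= last_a.
  - by lia.
have nlast_a : ~~ last_occ a by move: lt_2; case: last_occ => //; case: is_key.
(* As many non-key cells have been passed as non-last items placed; [a] is one more such item, so a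
   non-key cell remains. *)
have lt_xn : x < n.
  rewrite ltn_neqAle le_xn andbT; apply/eqP=> xn.
  have : below [pred c | ~~ last_occ c] a.+1 <= below [pred c | ~~ last_occ c] n.
    exact: below_mono.
  by rewrite belowS cnt xn !belowT card_not_last_occ /= nlast_a ltnn.
have [y xE] : exists y : 'I_n, x = y by exists (Ordinal lt_xn).
rewrite {x le_xn}xE in s_r1 tau_key cnt le_k lt_xn *.
apply: wp_then; apply: (@wp_loadE y (Posz (code a tau y)));
  rewrite /= ?s_r1 ?cell_ord //.
(* Cell [y] may or may not hold a target already, so only its parity is examined and [t] stays
   abstract. *)
have [t code_y] : exists t, code a tau y = is_key y + t.*2 by eexists.
have t_le : t <= 2 * n by have := code_le a tau y; rewrite code_y; lia.
apply: wp_then; apply: (@wp_arith (Posz t)) => /=.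
- by rewrite code_y divz_nat divn2 half_bit_double.
- by lia.
apply: wp_then; apply: (@wp_arith (Posz t.*2)) => /=.
- by lia.
- by lia.
apply: wp_if; rewrite /= code_y; case: ifP => cond; last first.
  have key_y : is_key y by move: cond; case: is_key => //; lia.
  apply: (@wp_arith (Posz y.+2)); [by rewrite /= s_r1 /=; lia|by move=> _ /=; lia|].
  exists a, y.+1, tau; split=> //.
  - split=> // c lt_c nlc; have [? lt_y] := tau_key c lt_c nlc.
    by split=> //; apply: ltnW.
  - by rewrite belowS /= key_y.
  - by lia.
have nkey_y : ~~ is_key y by move: cond; case: is_key => //; lia.
apply: wp_then; apply: (@wp_loadE a (Posz (is_key a)));
  rewrite /= ?s_r0 ?cell_ord //.
  by rewrite Es code_a (negPf nlast_a) addn0.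
apply: wp_then; apply: (@wp_arith (Posz y.+1.*2)) => /=.
- by rewrite s_r1 /=; lia.
- by lia.
apply: wp_then; apply: (@wp_arith (Posz (is_key a + y.+1.*2))) => /=.
- by lia.
- by case: is_key; lia.
apply: wp_then; apply: (@wp_storeE a (Posz (is_key a + y.+1.*2)));
  rewrite /= ?s_r0 ?cell_ord //.
  by move=> [] /(_ r2).
apply: wp_then; apply: (@wp_arith (Posz a.+2));
  [by rewrite /= s_r0 /=; lia|by move=> _ /=; lia|].
apply: (@wp_arith (Posz y.+2)); [by rewrite /= s_r1 /=; lia|by move=> _ /=; lia|].
exists a.+1, y.+1, [eta tau with a |-> y]; split=> //.
- move=> c; rewrite /= Es /code; case: (eqVneq c a) => [->|/eqP ne_ca] /=.
    by rewrite eqxx ltnS leqnn orbT.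
  by rewrite ltnS_neq // (introF eqP ne_ca).
- split=> [c last_c|c lt_c nlc|c c' nlc nlc' lt_cc' lt_c'] /=.
  + case: eqP => [ca|_]; last exact: tau_last.
    by move: last_c; rewrite ca (negPf nlast_a).
  + case: eqP => [//|ne_ca]; rewrite ltnS_neq // in lt_c.
    by have [? lt_y] := tau_key c lt_c nlc; split=> //; apply: ltnW.
  + have lt_ca : c < a by apply: leq_trans lt_cc' _.
    case: (eqVneq c a) => [ca|_]; first by rewrite ca ltnn in lt_ca.
    case: (eqVneq c' a) => [_|/eqP ne_c'a]; first by case: (tau_key c lt_ca nlc).
    by apply: tau_mono => //; rewrite -(ltnS_neq ne_c'a).
- by rewrite !belowS /= nlast_a nkey_y cnt.
- by lia.
Qed.

(** * Correctness of the ranks *)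

Definition rank (i : 'I_n) : nat :=
  #|[pred j : 'I_n | (f j < f i) || (f j == f i) && (j < i)]|.

Lemma rank_lt i : rank i < n.
Proof.
rewrite -[ltnRHS]card_ord; apply/proper_card/properP; split; first exact/subsetP.
by exists i; rewrite // !inE !ltnn andbF.
Qed.

Definition rank_ord (i : 'I_n) : 'I_n := Ordinal (rank_lt i).

(** The lexicographic order on keys and initial indices is transitive, and [i] is counted in the
    rank of [j] but not in its own. *)
Lemma rank_mono i j :
  (f i < f j) || (f i == f j) && (i < j) -> rank i < rank j.
Proof.
move=> lt_ij; apply/proper_card/properP; split; last first.
  by exists i; rewrite !inE // !ltnn andbF.
apply/subsetP=> k; rewrite !inE.
case/orP: lt_ij => [lt_ij|/andP[/eqP<- lt_ij]].
  by case/orP=> [/ltn_trans->//|/andP[/eqP-> _]]; rewrite lt_ij.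
by case/orP=> [->//|/andP[-> /ltn_trans->//]]; rewrite orbT.
Qed.

Lemma rank_ord_inj : injective rank_ord.
Proof.
move=> i j [eq_ij]; apply/eqP; case: (ltngtP (f i) (f j)) => [lt_f|lt_f|eq_f].
- by have := @rank_mono i j; rewrite lt_f eq_ij ltnn => /(_ isT).
- by have := @rank_mono j i; rewrite lt_f eq_ij ltnn => /(_ isT).
move/val_inj: eq_f => eq_f; rewrite -val_eqE; case: ltngtP => // lt_ij.
- by have := @rank_mono i j; rewrite lt_ij eq_ij ltnn eq_f eqxx orbT => /(_ isT).
- by have := @rank_mono j i; rewrite lt_ij eq_ij ltnn eq_f eqxx orbT => /(_ isT).
Qed.

(** The item at position [p] has rank [p], so order and stability both follow from [rank_mono]. *)
Lemma stably_sorted_rank d : (forall i, d (rank_ord i) = i) -> stably_sorted f d.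
Proof.
move=> dK; have rK : cancel d rank_ord.
  (* Injectivity on a finite type turns the one-sided inverse into a two-sided one. *)
  by have [r rK Kr] := injF_bij rank_ord_inj => p; rewrite -(Kr p) dK.
have rankd p : rank (d p) = p by rewrite -[in RHS](rK p).
split=> [|p q le_pq|p q eq_f lt_d]; first exact: can_inj rK.
  rewrite leqNgt; apply/negP=> lt_f.
  have := @rank_mono (d q) (d p); rewrite lt_f !rankd => /(_ isT).
  by rewrite ltnNge le_pq.
by have := @rank_mono (d p) (d q); rewrite lt_d eq_f eqxx orbT !rankd => /(_ isT).
Qed.

(** Last items go to keys and the others to non-keys, injectively in either case. *)
Lemma layout_inj tau : layout tau -> injective tau.
Proof.
case=> tau_last tau_key tau_mono i j eq_tau.
have key i' : is_key (f i') by apply/existsP; exists i'.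
case li: (last_occ i); case lj: (last_occ j).
- by apply: last_occ_inj => //; rewrite -!tau_last.
- by have := tau_key j; rewrite lj -eq_tau tau_last // key => /(_ isT).
- by have := tau_key i; rewrite li eq_tau tau_last // key => /(_ isT).
apply/val_inj; case: (ltngtP i j) => // lt_ij.
- by have := tau_mono i j; rewrite li lj eq_tau ltnn => /(_ isT isT lt_ij).
- by have := tau_mono j i; rewrite li lj eq_tau ltnn => /(_ isT isT lt_ij).
Qed.

(** * Ranks read off from the array after the layout *)

Section Layout.

Variables (tau : 'I_n -> 'I_n) (d : {perm 'I_n}).
Hypotheses (tau_layout : layout tau) (dK : cancel d tau).

(** The role of a cell can thus be read off from [D] alone, so the marks in [E] may be erased. *)
Lemma layout_last p : last_occ (d p) = (f (d p) == p).
Proof.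
case: tau_layout => tau_last tau_key _.
case ld: (last_occ (d p)); first by rewrite -tau_last // dK eqxx.
apply/esym/negbTE/negP=> /eqP fdp.
have := tau_key (d p); rewrite ld dK => /(_ isT)/existsPn/(_ (d p)).
by rewrite fdp eqxx.
Qed.

(** The cell numbered by a key holds the last item with that key; this is what [hoare_set_ranks]
    assumes. *)
Lemma layout_key p : f (d (f (d p))) = f (d p).
Proof.
have key : is_key (f (d p)) by apply/existsP; exists (d p).
have [i li <-] := ex_last_occ key.
have [tau_last _ _] := tau_layout.
have tauK : cancel tau d by apply: (canF_sym dK).
by rewrite -[in LHS](tau_last i li) tauK.
Qed.

(** The last item of a class is preceded by all the others, hence the bound [n] at its cell. The
    others keep their original order in non-key cells, so those preceding one of them lie in the
    non-key cells of the class below it. *)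
Lemma layout_rank c :
  #|[pred p | f (d p) < f (d c)]| +
    below [pred p | (f (d p) == f (d c)) && (p != f (d p))]
          (if f (d c) == c then n else c) = rank (d c).
Proof.
have [_ _ tau_mono] := tau_layout.
have last_le p q : last_occ (d q) -> f (d p) = f (d q) -> d p <= d q.
  by move=> /forallP/(_ (d p))/implyP le_q eq_f; apply: le_q; rewrite eq_f.
pose A := [pred p | f (d p) < f (d c)].
pose B := [pred p | (f (d p) == f (d c)) && (d p < d c)].
have -> : rank (d c) = #|A| + #|B|.
  (* [rank] counts items while the passes over the array count cells; [d] carries one count to the
     other. *)
  rewrite /rank -sum1_card (reindex_inj (@perm_inj _ d)) sum1_card -cardUI.
  rewrite (@eq_card0 _ [predI A & B]) ?addn0 // => p.
  by rewrite !inE; case: eqP => [->|]; rewrite ?ltnn ?andbF.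
congr (_ + _); apply: eq_card => p; rewrite !inE.
case: eqP => //= eq_f; rewrite eq_f.
case: (f (d c) =P c) => [key_c|nkey_c].
  rewrite ltn_ord andbT key_c.
  have lc : last_occ (d c) by rewrite layout_last key_c.
  by rewrite ltn_neqAle (last_le p c) // andbT val_eqE (inj_eq perm_inj).
have nlc : ~~ last_occ (d c) by rewrite layout_last; apply/eqP.
case: (eqVneq p (f (d c))) => [key_p|nkey_p] /=.
  have lp : last_occ (d p) by rewrite layout_last eq_f key_p.
  by rewrite ltnNge last_le.
have nlp : ~~ last_occ (d p) by rewrite layout_last eq_f eq_sym.
case: (ltngtP (d p) (d c)) => [lt_d|lt_d|/val_inj/perm_inj->]; last by rewrite ltnn.
- by have := tau_mono _ _ nlp nlc lt_d; rewrite !dK.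
- by have := tau_mono _ _ nlc nlp lt_d; rewrite !dK => /ltnW; rewrite ltnNge => ->.
Qed.

(** * Assembling the passes *)

Definition sort_by_rank : cmd :=
  clear_E;; count_keys;; start_ranks;; set_ranks;; permute.

Lemma hoare_sort_by_rank :
  hoare (fun s => arrD s =1 d) sort_by_rank (49 * n + 16)
    (fun s => stably_sorted f (arrD s)).
Proof.
have -> : 49 * n + 16 =
    n * 4 + 3 + (n * 7 + 3 + (n * 6 + 4 + (n * 8 + 3 + (2 * n * 12 + 3)))) by lia.
apply: hoare_then (@hoare_clear_E d) _.
apply: hoare_then (@hoare_count_keys d) _.
apply: hoare_then (@hoare_start_ranks d) _.
apply: hoare_then (@hoare_set_ranks d layout_key) _.
(* [sigma] sends a cell to the rank of the item in it, and [d'] is the array with every item at its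
   rank. *)
pose sigma := perm (inj_comp rank_ord_inj (@perm_inj _ d)).
pose d' p := d (sigma^-1 p)%g.
apply: hoare_impl (@hoare_permute d') => [s [Ds Es]|s Ds].
  exists sigma; split=> p; last by rewrite /d' permK Ds.
  by rewrite Es layout_rank permE.
apply: stably_sorted_rank => i.
have -> : rank_ord i = sigma (d^-1 i)%g by rewrite permE /= permKV.
by rewrite Ds /d' permK permKV.
Qed.

End Layout.

Definition stable_sort : cmd :=
  clear_E;; mark;; place;; halve_E;; permute;; sort_by_rank.

Lemma hoare_stable_sort :
  hoare (fun s => arrD s =1 id) stable_sort (130 * n + 32)
    (fun s => stably_sorted f (arrD s)).
Proof.
have -> : 130 * n + 32 = n * 4 + 3 + (n * 15 + 3 + (2 * n * 16 + 4 +
    (n * 6 + 3 + (2 * n * 12 + 3 + (49 * n + 16))))) by lia.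
apply: hoare_then (@hoare_clear_E id) _.
apply: hoare_then (@hoare_mark) _.
apply: hoare_then (@hoare_place) _.
move=> k s [tau Ltau Es].
(* [tau] sends an item to its cell, so the array after the first permutation is its inverse. *)
pose d := (perm (layout_inj Ltau))^-1%g.
have dK : cancel d tau by move=> p; rewrite -(permE (layout_inj Ltau)) permKV.
pose A s := arrD s =1 id /\ forall c, arrE s c = Posz (is_key c + (tau c).+1.*2).
have : hoare A (halve_E;; permute;; sort_by_rank)
    (n * 6 + 3 + (2 * n * 12 + 3 + (49 * n + 16)))
    (fun s => stably_sorted f (arrD s)).
  apply: hoare_then (@hoare_halve_E id is_key (fun c => (tau c).+1)) _.
  apply: hoare_then (@hoare_sort_by_rank tau d Ltau dK).
  apply: hoare_impl (@hoare_permute d) => // {Es s} s [Ds Es].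
  exists (perm (layout_inj Ltau)); split=> p; first by rewrite Es permE.
  by rewrite Ds permK.
exact.
Qed.

End Logic.

Theorem theorem4p3 :
  exists (P : program) (c : nat),
    forall (n : nat) (hn : 1 <= n) (f : 'I_n -> 'I_n),
      stably_sorts_in_linear_time P c f.
Proof.
(* The constant is 130 + 32, since [130 * n + 32 <= 162 * n] for [n >= 1]; it also exceeds the 4
   required for the stored integers. *)
exists (compile 0 stable_sort), 162 => n n_gt0 f s0 [pc0 D0] fits0.
have le_4nm : 4 * n <= 162 * n by lia.
have code : code_at (compile 0 stable_sort) 0 (compile 0 stable_sort) by [].
have [t [k [s [tE [rn fit] [_ sorted]]]]] :=
  hoare_stable_sort le_4nm n_gt0 0 D0 code fits0.
have s0E : goto s0 0 = s0 by case: s0 pc0 {D0 fits0 tE rn fit} => ? ? ? ? /= ->.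
rewrite s0E in rn fit; exists t, (goto s (0 + csize stable_sort)); split=> //.
by lia.
Qed.
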